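(* The automorphism group of any oriented Fano plane $(\mathcal{F},\rightarrow)$ is isomorphic to the Frobenius group $F_{21}$ of order $21$ (the unique non-abelian group of order 21).
   Context: A Fano plane is a pair $(\mathcal{V},\mathcal{B})$ with $|\mathcal{V}|=7$ and $\mathcal{B}$ a collection of 3-subsets (blocks) such that every 2-subset lies in exactly one block; an automorphism is a permutation $\sigma$ of $\mathcal{V}$ with $T\in\mathcal{B}$ iff $\sigma(T)\in\mathcal{B}$. An orientation on $\mathcal{F}$ is an antisymmetric binary relation $\rightarrow$ on $\mathcal{V}$ such that (i) for every block $\{x_1,x_2,x_3\}$, either $x_1\rightarrow x_2\rightarrow x_3\rightarrow x_1$ or $x_1\rightarrow x_3\rightarrow x_2\rightarrow x_1$; (ii) for every $x$, if $\{x,y_i,z_i\}$ ($i=1,2,3$) are the three blocks through $x$ and $x\rightarrow y_i$ for all $i$, then $\{y_1,y_2,y_3\}\in\mathcal{B}$. An oriented Fano plane is a pair $(\mathcal{F},\rightarrow)$ with $\rightarrow$ an orientation on $\mathcal{F}$; its automorphisms are the automorphisms $\sigma$ of $\mathcal{F}$ such that $\sigma(x)\rightarrow\sigma(y)$ iff $x\rightarrow y$, for all $x,y\in\mathcal{V}$.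
   Formalization: ''Antisymmetric'' is taken to mean that x→y excludes y→x, also for x=y, so loops x→x are forbidden; if loops were allowed, an orientation with a single loop would have an automorphism group of order 3 and the claim would fail. *)

(* Defs.v *)
From HB Require Import structures.
From mathcomp Require Import all_boot all_order all_algebra all_fingroup.

Set Implicit Arguments.
Unset Strict Implicit.
Unset Printing Implicit Defensive.

Import GRing.Theory GroupScope.

Section FanoPlane.

Variables (V : finType) (B : {set {set V}}).

Definition fano_plane : Prop :=
  [/\ #|V| = 7,
      forall T : {set V}, T \in B -> #|T| = 3
    & forall P : {set V}, #|P| = 2 -> exists! T : {set V}, T \in B /\ P \subset T].

Definition fano_aut (s : {perm V}) : bool :=
  [forall T : {set V}, (T \in B) == (s @: T \in B)].

(* The first clause reads "antisymmetric" as "never both x -> y and y -> x",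
   the case x = y included: the other clauses do not constrain loops x -> x,
   which every automorphism would have to respect. *)
Definition orientation (r : rel V) : Prop :=
  [/\ forall x y, r x y -> ~~ r y x,
      forall x1 x2 x3, [set x1; x2; x3] \in B ->
        [/\ r x1 x2, r x2 x3 & r x3 x1] \/ [/\ r x1 x3, r x3 x2 & r x2 x1]
    & forall x y1 y2 y3 z1 z2 z3,
        [set T in B | x \in T]
          = [set [set x; y1; z1]; [set x; y2; z2]; [set x; y3; z3]] ->
        r x y1 -> r x y2 -> r x y3 -> [set y1; y2; y3] \in B].

Definition oriented_fano_plane (r : rel V) : Prop :=
  fano_plane /\ orientation r.

Definition oriented_fano_Aut (r : rel V) : {set {perm V}} :=
  [set s : {perm V} | fano_aut s && [forall x, forall y, r (s x) (s y) == r x y]].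

Lemma oriented_fano_Aut_group_set (r : rel V) : group_set (oriented_fano_Aut r).
Proof.
apply/group_setP; split=> [|s t].
  rewrite inE; apply/andP; split.
    apply/forallP=> T; suff -> : (1 : {perm V}) @: T = T by [].
    by rewrite -[RHS]imset_id; apply: eq_imset => x; rewrite perm1.
  by apply/forallP=> x; apply/forallP=> y; rewrite !perm1.
rewrite !inE => /andP[/forallP sB /forallP sr] /andP[/forallP tB /forallP tr].
apply/andP; split.
  apply/forallP=> T; rewrite (eqP (sB T)) (eqP (tB _)).
  suff -> : (s * t) @: T = t @: (s @: T) by [].
  by rewrite -imset_comp; apply: eq_imset => x; rewrite permM.
apply/forallP=> x; apply/forallP=> y; rewrite !permM.
by rewrite (eqP (forallP (tr _) _)) (eqP (forallP (sr _) _)).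
Qed.

Canonical oriented_fano_Aut_group (r : rel V) :=
  Group (oriented_fano_Aut_group_set r).

End FanoPlane.

(* The Frobenius group of order 21, as the permutations x |-> a x + b of the
   field with 7 elements with a in the subgroup {1, 2, 4} of cube roots of 1. *)
Definition F21 : {set {perm 'F_7}} :=
  [set s : {perm 'F_7} | [exists a : 'F_7, exists b : 'F_7,
     (a ^+ 3 == 1)%R && [forall x, s x == (a * x + b)%R]]].

Lemma F21P (s : {perm 'F_7}) :
  reflect (exists a b : 'F_7, (a ^+ 3 = 1)%R /\ forall x, s x = (a * x + b)%R)
          (s \in F21).
Proof.
rewrite inE; apply: (iffP existsP) => [[a /existsP[b /andP[/eqP a3 /forallP sE]]]|].
  by exists a, b; split=> // x; apply/eqP.
case=> a [b [a3 sE]]; exists a; apply/existsP; exists b.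
by rewrite a3 eqxx; apply/forallP=> x; rewrite sE.
Qed.

Lemma F21_group_set : group_set F21.
Proof.
apply/group_setP; split=> [|s t].
  apply/F21P; exists 1%R, 0%R; split; first by rewrite expr1n.
  by move=> x; rewrite perm1 mul1r addr0.
case/F21P=> a [b [a3 sE]] /F21P[c [d [c3 tE]]].
apply/F21P; exists (c * a)%R, (c * b + d)%R; split.
  by rewrite exprMn a3 c3 mulr1.
by move=> x; rewrite permM sE tE mulrDr mulrA addrA.
Qed.

Canonical F21_group := Group F21_group_set.

Definition affine7 (a b : 'F_7) (x : 'F_7) : 'F_7 := (a * x + b)%R.

Lemma affine7_inj a b : (a ^+ 3 = 1)%R -> injective (affine7 a b).
Proof.
move=> a3 x y /addIr; apply: mulfI; apply: contra_eq_neq a3 => ->.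
by rewrite expr0n.
Qed.

Lemma F21_mem a b (a3 : (a ^+ 3 = 1)%R) : perm (@affine7_inj a b a3) \in F21.
Proof. by apply/F21P; exists a, b; split=> // x; rewrite permE. Qed.

Lemma card_F21 : #|F21| = 21.
Proof.
pose g (s : {perm 'F_7}) : 'F_7 * 'F_7 := ((s 1 - s 0)%R, s 0%R).
have gE (s : {perm 'F_7}) a b : (forall x, s x = (a * x + b)%R) -> g s = (a, b).
  by move=> sE; rewrite /g !sE mulr1 mulr0 add0r addrK.
have g_inj : {in F21 &, injective g}.
  move=> s t /F21P[a [b [_ sE]]] /F21P[c [d [_ tE]]].
  rewrite (gE _ _ _ sE) (gE _ _ _ tE) => -[ac bd].
  by apply/permP=> x; rewrite sE tE ac bd.
rewrite -(card_in_imset g_inj).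
have -> : g @: F21 = setX [set a : 'F_7 | (a ^+ 3 == 1)%R] setT.
  apply/setP=> -[a b]; rewrite !inE andbT.
  apply/imsetP/eqP => [[s /F21P[c [d [c3 sE]]]]|a3].
    by rewrite (gE _ _ _ sE) => -[-> _].
  exists (perm (@affine7_inj a b a3)); first exact: F21_mem.
  by rewrite (gE _ a b) // => x; rewrite permE.
rewrite cardsX cardsT card_Fp //.
suff -> : [set a : 'F_7 | (a ^+ 3 == 1)%R] = [set 1%R; 2%:R%R; 4%:R%R].
  by rewrite -setUA !cardsU1 cards1 !inE.
apply/setP=> -[m lt_m]; rewrite !inE.
by do 7?[case: m lt_m => [|m] lt_m //].
Qed.

Lemma F21_nonabelian : ~~ abelian F21.
Proof.
have e1 : (1 ^+ 3 = 1 :> 'F_7)%R by rewrite expr1n.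
have e2 : (2%:R ^+ 3 = 1 :> 'F_7)%R by apply/eqP.
apply/negP=> /centsP/(_ _ (F21_mem 1%R e1) _ (F21_mem 0%R e2)).
by move/permP/(_ 0%R); rewrite !permM !permE /affine7 => /eqP.
Qed.

(* Main.v *)
(** In an oriented Fano plane every out-neighbourhood is a block, and two blocks
    meet, so any two points have a common out-neighbour. Starting from a point
    [v0] with out-neighbours [v1 -> v2 -> v4 -> v1], common out-neighbours [v3],
    [v5], [v6] of the pairs [(v1, v2)], [(v4, v1)], [(v2, v4)] complete a
    labelling of the points by the field with 7 elements, for which [x -> y]
    means that [y - x] is a nonzero square: the cyclic orientation of the
    out-neighbourhoods forces all the other arrows. The blocks are exactly the
    out-neighbourhoods, so the automorphism group is that of the Paley
    tournament on 7 points. An automorphism of the latter is determined by the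
    images of [0] and [1], hence is affine with a square slope. *)
Require Import Defs.
From mathcomp Require Import all_boot all_order all_algebra all_fingroup.

Set Implicit Arguments.
Unset Strict Implicit.
Unset Printing Implicit Defensive.

Import GRing.Theory.

Local Open Scope group_scope.

(** * Sets with three elements *)

Lemma cards3P (T : finType) (A : {set T}) : #|A| = 3 ->
  exists x y z, [/\ x != y, x != z, y != z & A = [set x; y; z]].
Proof.
move=> A3; have /card_gt0P[x xA] : 0 < #|A| by rewrite A3.
have /eqP/cards2P[y [z [yz AxE]]] : #|A :\ x| = 2.
  by apply/eqP; rewrite -eqSS -A3 (cardsD1 x A) xA.
have : y \in A :\ x by rewrite AxE !inE eqxx.
have : z \in A :\ x by rewrite AxE !inE eqxx orbT.
rewrite !in_setD1 => /andP[zx _] /andP[yx _].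
exists x, y, z; split; rewrite // 1?eq_sym //.
by rewrite -setUA -AxE setD1K.
Qed.

Lemma cards3_uniq (T : finType) (x y z : T) (A : {set T}) :
  #|A| = 3 -> x \in A -> y \in A -> z \in A ->
  x != y -> x != z -> y != z -> A = [set x; y; z].
Proof.
move=> A3 xA yA zA xy xz yz; apply/esym/eqP.
rewrite eqEcard !subUset !sub1set xA yA zA A3 -setUA !cardsU1 cards1 !inE.
by rewrite (negPf xy) (negPf xz) (negPf yz).
Qed.

(** * Incidence in a Fano plane *)

Section Fano.

Variables (V : finType) (B : {set {set V}}).
Hypothesis hB : fano_plane B.

Lemma card_block T : T \in B -> #|T| = 3.
Proof. by case: hB => _ + _; apply. Qed.

(** For distinct points the default [set0] is never reached. *)
Definition line (x y : V) : {set V} :=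
  odflt set0 [pick T in B | [set x; y] \subset T].

Lemma lineP x y : x != y ->
  [/\ line x y \in B, x \in line x y & y \in line x y].
Proof.
move=> xy; case: hB => _ _ /(_ [set x; y]); rewrite cards2 xy => /(_ erefl).
case=> T [[TB xyT] _]; rewrite /line; case: pickP => [U|/(_ T)] /=; last first.
  by rewrite TB xyT.
by case/andP=> UB; rewrite subUset !sub1set => /andP[].
Qed.

Lemma block_uniq x y T U : x != y -> T \in B -> U \in B ->
  x \in T -> y \in T -> x \in U -> y \in U -> T = U.
Proof.
move=> xy TB UB xT yT xU yU.
case: hB => _ _ /(_ [set x; y]); rewrite cards2 xy => /(_ erefl)[W [_ WE]].
by rewrite -[LHS]WE -1?[RHS]WE // subUset !sub1set ?xT ?xU.
Qed.

(** Double counting: sending [y] to [line x y] partitions the six points other than [x], and each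
    block through [x] receives its two remaining points. *)
Lemma card_blocks_through x : #|[set T in B | x \in T]| = 3.
Proof.
have V6 : #|[set~ x]| = 6 by rewrite cardsC1; case: hB => ->.
apply/eqP; rewrite -(eqn_pmul2r (isT : 0 < 2)) -[(3 * 2)%N]V6.
rewrite -[eqbRHS]sum1_card.
rewrite (partition_big (line x) (mem [set T in B | x \in T])) /=; last first.
  by move=> y; rewrite !inE eq_sym => /lineP[-> ->].
rewrite -sum_nat_const; apply/eqP/eq_bigr => T; rewrite inE => /andP[TB xT].
transitivity #|T :\ x|.
  by apply/eqP; rewrite -eqSS -(card_block TB) (cardsD1 x T) xT.
rewrite -sum1_card; apply: eq_bigl => y; rewrite !inE.
have [//|/= yx] := eqVneq y x; rewrite eq_sym in yx.
have [lB xl yl] := lineP yx; apply/idP/eqP => [yT|<- //].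
exact: (block_uniq yx).
Qed.

(** If [p] in [U] lies outside [T], the lines from [p] to the three points of [T] are distinct, so
    they are all the blocks through [p], and [U] is one of them. *)
Lemma blocks_meet T U : T \in B -> U \in B -> exists2 x, x \in T & x \in U.
Proof.
move=> TB UB; have /card_gt0P[p pU] : 0 < #|U| by rewrite card_block.
have [pT|pNT] := boolP (p \in T); first by exists p.
have pN q : q \in T -> p != q by apply: contraTneq => <-.
have line_inj : {in T &, injective (line p)}.
  move=> q q' qT q'T eql; apply: contraNeq pNT => qq'.
  have [lB pl ql] := lineP (pN _ qT); have [_ _] := lineP (pN _ q'T).
  by rewrite -eql => q'l; rewrite (block_uniq qq' TB lB).
have : U \in line p @: T.
  suff -> : line p @: T = [set T in B | p \in T] by rewrite inE UB.
  apply/eqP; rewrite eqEcard card_in_imset // card_blocks_through card_block //.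
  rewrite andbT; apply/subsetP=> _ /imsetP[q qT ->].
  by have [lB pl _] := lineP (pN _ qT); rewrite inE lB.
by case/imsetP=> q qT ->; exists q => //; case: (lineP (pN _ qT)).
Qed.

End Fano.

(** * Out-neighbourhoods in an oriented Fano plane *)

Section OrientedFano.

Variables (V : finType) (B : {set {set V}}) (r : rel V).
Hypothesis hr : oriented_fano_plane B r.

Let hB : fano_plane B. Proof. by case: hr. Qed.

Lemma orientation_asym x y : r x y -> r y x = false.
Proof. by case: hr => _ [asym _ _] /asym/negPf. Qed.

Lemma orientation_irr x : r x x = false.
Proof. by apply/negP => /[dup]/orientation_asym->. Qed.

Lemma orientation_neq x y : r x y -> x != y.
Proof. by apply: contraTneq => ->; rewrite orientation_irr. Qed.

Lemma block_cyclic x y z : [set x; y; z] \in B -> r x y -> r y z /\ r z x.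
Proof.
case: hr => _ [_ cyc _] /cyc[[]//|[_ _ ryx] rxy].
by rewrite (orientation_asym rxy) in ryx.
Qed.

Lemma block_split x T : T \in B -> x \in T ->
  exists y z, [/\ T = [set x; y; z], r x y & r z x].
Proof.
move=> TB xT; have /eqP/cards2P[y [z [_ TxE]]] : #|T :\ x| = 2.
  by apply/eqP; rewrite -eqSS -(card_block hB TB) (cardsD1 x T) xT.
have TE : T = [set x; y; z] by rewrite -setUA -TxE setD1K.
case: hr => _ [_ cyc _]; move: (TB); rewrite {1}TE => /cyc[[]|[]] *.
  by exists y, z.
by exists z, y; split=> //; rewrite TE setUAC.
Qed.

Definition out_nbrs x : {set V} := [set y | r x y].

(** Each of the three blocks through [x] contains one successor of [x]; clause (ii) makes these
    successors a block, and they are all the out-neighbours. *)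
Lemma out_nbrs_block x : out_nbrs x \in B.
Proof.
have [T1 [T2 [T3 [_ _ _ SE]]]] := cards3P (card_blocks_through hB x).
have inS T : T \in [set T1; T2; T3] -> T \in B /\ x \in T.
  by rewrite -SE inE => /andP[].
have [|T1B xT1] := inS T1; first by rewrite !inE eqxx.
have [|T2B xT2] := inS T2; first by rewrite !inE eqxx orbT.
have [|T3B xT3] := inS T3; first by rewrite !inE eqxx orbT.
have [y1 [z1 [T1E xy1 zx1]]] := block_split T1B xT1.
have [y2 [z2 [T2E xy2 zx2]]] := block_split T2B xT2.
have [y3 [z3 [T3E xy3 zx3]]] := block_split T3B xT3.
have yB : [set y1; y2; y3] \in B.
  case: hr => _ [_ _ /(_ x y1 y2 y3 z1 z2 z3)]; rewrite -T1E -T2E -T3E.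
  exact.
suff -> : out_nbrs x = [set y1; y2; y3] by [].
apply/setP=> y; rewrite !inE; apply/idP/idP => [xy|]; last first.
  by case/orP=> [/orP[]|] /eqP->.
have yx := orientation_neq xy.
have [lB xl yl] := lineP hB yx.
(* In the block joining it to [x], an out-neighbour [y] is neither [x] nor the predecessor of
   [x]. *)
have : line B x y \in [set T1; T2; T3] by rewrite -SE inE lB.
have notin z : r z x -> (y == z) = false.
  by apply: contraTF => /eqP<-; rewrite orientation_asym.
move: yl; rewrite !inE => + /orP[/orP[]|] /eqP lE.
all: rewrite lE ?T1E ?T2E ?T3E !inE (eq_sym y x) (negPf yx).
all: rewrite ?(notin _ zx1) ?(notin _ zx2) ?(notin _ zx3) orbF /=.
all: by move=> ->; rewrite ?orbT.
Qed.

Lemma orientation_total x y : x != y -> r x y || r y x.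
Proof.
move=> xy; have [lB xl yl] := lineP hB xy.
have [u [v [lE rxu rvx]]] := block_split lB xl.
move: yl; rewrite lE !inE eq_sym (negPf xy) /= => /orP[] /eqP->.
  by rewrite rxu.
by rewrite rvx orbT.
Qed.

Lemma common_out x y : exists2 z, r x z & r y z.
Proof.
have [z] := blocks_meet hB (out_nbrs_block x) (out_nbrs_block y).
by rewrite !inE; exists z.
Qed.

(** The three points fill the out-neighbourhood of [x], a block, and the arrow from [a] to [b] fixes
    the sense of its cycle. *)
Lemma out_nbrs_cyclic x a b c :
  r x a -> r x b -> r x c -> r a b -> b != c -> a != c -> r b c /\ r c a.
Proof.
move=> xa xb xc ab bc ac; apply: block_cyclic (ab).
rewrite -(@cards3_uniq _ a b c (out_nbrs x)) ?inE // ?out_nbrs_block //.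
  exact/(card_block hB)/out_nbrs_block.
exact: orientation_neq.
Qed.

End OrientedFano.

(** * The Paley tournament on 7 points *)

(* In the field with 7 elements the nonzero squares are the cube roots of 1. *)
Definition paley7 : rel 'F_7 := fun i j => ((j - i) ^+ 3 == 1)%R.

(** Case analysis with numerals, so that instances of [paley7] compute. *)
Lemma F7_ind (P : 'F_7 -> Prop) :
  P 0%R -> P 1%R -> P 2%:R%R -> P 3%:R%R -> P 4%:R%R -> P 5%:R%R -> P 6%:R%R ->
  forall x, P x.
Proof.
move=> P0 P1 P2 P3 P4 P5 P6 [[|[|[|[|[|[|[|m]]]]]]] lt_m] //.
- by move: P0; congr P; apply/val_inj.
- by move: P1; congr P; apply/val_inj.
- by move: P2; congr P; apply/val_inj.
- by move: P3; congr P; apply/val_inj.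
- by move: P4; congr P; apply/val_inj.
- by move: P5; congr P; apply/val_inj.
- by move: P6; congr P; apply/val_inj.
Qed.

(** In the order 2, 4, 3, 5, 6, each point is the only one with its arrows to or from two points
    already known to be fixed. *)
Lemma paley7_rigid (t : 'F_7 -> 'F_7) :
  (forall i j, paley7 (t i) (t j) = paley7 i j) ->
  t 0%R = 0%R -> t 1%R = 1%R -> t =1 id.
Proof.
move=> tP t0 t1.
have t2 : t 2%:R%R = 2%:R%R.
  have := tP 0%R 2%:R%R; have := tP 1%R 2%:R%R; rewrite t0 t1.
  by elim/F7_ind: (t 2%:R%R).
have t4 : t 4%:R%R = 4%:R%R.
  have := tP 0%R 4%:R%R; have := tP 4%:R%R 1%R; rewrite t0 t1.
  by elim/F7_ind: (t 4%:R%R).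
have t3 : t 3%:R%R = 3%:R%R.
  have := tP 1%R 3%:R%R; have := tP 2%:R%R 3%:R%R; rewrite t1 t2.
  by elim/F7_ind: (t 3%:R%R).
have t5 : t 5%:R%R = 5%:R%R.
  have := tP 1%R 5%:R%R; have := tP 4%:R%R 5%:R%R; rewrite t1 t4.
  by elim/F7_ind: (t 5%:R%R).
have t6 : t 6%:R%R = 6%:R%R.
  have := tP 2%:R%R 6%:R%R; have := tP 4%:R%R 6%:R%R; rewrite t2 t4.
  by elim/F7_ind: (t 6%:R%R).
by elim/F7_ind.
Qed.

Lemma paley7_common_in x y : x != y -> exists2 k, paley7 k x & paley7 k y.
Proof.
elim/F7_ind: x; elim/F7_ind: y => // _.
all: first [by exists 0%R | by exists 1%R | by exists 2%:R%R
  | by exists 3%:R%R | by exists 4%:R%R | by exists 5%:R%R | by exists 6%:R%R].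
Qed.

Lemma paley7_affine (a b i j : 'F_7) : (a ^+ 3 = 1)%R ->
  paley7 (a * i + b)%R (a * j + b)%R = paley7 i j.
Proof.
by move=> a3; rewrite /paley7 opprD addrACA subrr addr0 -mulrBr exprMn a3 mul1r.
Qed.

Lemma F21_paley7 (s : {perm 'F_7}) :
  (s \in F21) = [forall i, forall j, paley7 (s i) (s j) == paley7 i j].
Proof.
apply/F21P/'forall_'forall_eqP => [[a [b [a3 sE]]] i j|sP].
  by rewrite !sE paley7_affine.
pose a := (s 1 - s 0)%R; have a3 : (a ^+ 3 = 1)%R.
  by have := sP 0%R 1%R; rewrite /paley7 -/a subr0 expr1n eqxx => /eqP.
have a0 : (a != 0)%R by apply: contra_eq_neq a3 => ->; rewrite expr0n.
exists a, (s 0%R); split=> // x.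
(* Undoing the affine map that agrees with [s] at 0 and 1 leaves a map to which rigidity applies. *)
pose t x := (a^-1 * (s x - s 0))%R.
have sE y : s y = (a * t y + s 0)%R by rewrite /t mulVKf // subrK.
rewrite [LHS]sE (@paley7_rigid t) //.
- by move=> i j; rewrite -(sP i j) (sE i) (sE j) paley7_affine.
- by rewrite /t subrr mulr0.
- by rewrite /t mulVf.
Qed.

(** * Labelling the points by the field with 7 elements *)

Section Labelling.

Variables (V : finType) (B : {set {set V}}) (r : rel V).
Hypothesis hr : oriented_fano_plane B r.

Lemma paley7_labelling :
  exists f : 'F_7 -> V, bijective f /\ forall i j, r (f i) (f j) = paley7 i j.
Proof.
case: (hr) => hB _; have asym := orientation_asym hr.
have irr := orientation_irr hr; have cyc := out_nbrs_cyclic hr.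
have neq := orientation_neq hr.
have /card_gt0P[v0 _] : 0 < #|V| by case: hB => ->.
have N0B := out_nbrs_block hr v0.
have /card_gt0P[v1 v1N0] : 0 < #|out_nbrs r v0| by rewrite (card_block hB).
have [v2 [v4 [N0E r12 r41]]] := block_split hr N0B v1N0.
have N0 y : r v0 y = [|| y == v1, y == v2 | y == v4].
  by have := in_set (r v0) y; rewrite -/(out_nbrs r v0) N0E !inE orbA.
have r01 : r v0 v1 by rewrite N0 eqxx.
have r02 : r v0 v2 by rewrite N0 eqxx orbT.
have r04 : r v0 v4 by rewrite N0 eqxx !orbT.
have r24 : r v2 v4.
  by case: (block_cyclic hr (x := v1) (y := v2) (z := v4)) => //; rewrite -N0E.
have [v3 r13 r23] := common_out hr v1 v2.
have [v5 r45 r15] := common_out hr v4 v1.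
have [v6 r26 r46] := common_out hr v2 v4.
(* The out-neighbourhood of [v] meets that of [v0]. *)
have no_sink v : ~ [/\ r v1 v, r v2 v & r v4 v].
  case=> r1v r2v r4v; have [w] := common_out hr v0 v.
  by rewrite N0 => /or3P[]/eqP->; rewrite asym.
have neq_by u v w : r u v -> ~~ r u w -> v != w.
  by move=> uv; apply: contraNneq => <-.
(* A common out-neighbour of two of [v1], [v2], [v4] is not one of the third; this helps to tell
   [v3], [v5] and [v6] apart. *)
have N43 : ~~ r v4 v3 by apply/negP => r43; case: (no_sink v3).
have N25 : ~~ r v2 v5 by apply/negP => r25; case: (no_sink v5).
have N16 : ~~ r v1 v6 by apply/negP => r16; case: (no_sink v6).
(* The out-neighbourhoods of [v1], [v2], [v4] are now known; in each, one known arrow yields the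
   other two. *)
have [||r35 r52] := cyc _ _ _ _ r12 r13 r15 r23.
- by rewrite eq_sym; apply: neq_by r45 _.
- by rewrite eq_sym; apply: neq_by r45 _; rewrite asym.
have [||r63 r34] := cyc _ _ _ _ r24 r26 r23 r46.
- exact: neq_by r46 _.
- by rewrite eq_sym; apply: neq_by r13 _; rewrite asym.
have [||r56 r61] := cyc _ _ _ _ r41 r45 r46 r15.
- exact: neq_by r15 _.
- by rewrite eq_sym; apply: neq_by r26 _; rewrite asym.
(* By totality, a point other than [v0] and its out-neighbours sends an arrow to [v0]. *)
have to0 u v : r v0 u -> r u v -> v != v1 -> v != v2 -> v != v4 -> r v v0.
  move=> r0u ruv v1' v2' v4'; have v0' : v0 != v.
    by rewrite eq_sym; apply: neq_by ruv _; rewrite asym.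
  case/orP: (orientation_total hr v0') => //.
  by rewrite N0 (negPf v1') (negPf v2') (negPf v4').
have neq' x y : r x y -> y != x by rewrite eq_sym; apply: neq.
have r30 := to0 _ _ r01 r13 (neq' _ _ r13) (neq' _ _ r23) (neq _ _ r34).
have r50 := to0 _ _ r01 r15 (neq' _ _ r15) (neq _ _ r52) (neq' _ _ r45).
have r60 := to0 _ _ r02 r26 (neq _ _ r61) (neq' _ _ r26) (neq' _ _ r46).
pose f (i : 'F_7) := nth v0 [:: v0; v1; v2; v3; v4; v5; v6] i.
(* The 21 arrows found, asymmetry and the absence of loops settle all 49 pairs. *)
have fP i j : r (f i) (f j) = paley7 i j.
  by elim/F7_ind: i; elim/F7_ind: j; rewrite ?[paley7 _ _]/= /f /= ?irr // asym.
exists f; split=> //; apply: inj_card_bij; last first.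
  by case: hB => ->; rewrite card_Fp.
(* Distinct labels are joined by an arrow, which equal images would turn into a loop. *)
move=> i j eqf; apply/eqP; apply: contraT => ij.
have := irr (f i); rewrite {2}eqf fP; have := irr (f j); rewrite -{2}eqf fP.
by elim/F7_ind: i ij {eqf}; elim/F7_ind: j.
Qed.

(** Two points of [T] have a common in-neighbour, whose out-neighbourhood is a block sharing both
    points with [T]. *)
Lemma block_out_nbrs T : T \in B -> exists x, T = out_nbrs r x.
Proof.
move=> TB; case: (hr) => hB _; have [f [[g fK gK] fP]] := paley7_labelling.
have [x [y [z [xy _ _ TE]]]] := cards3P (card_block hB TB).
have [|k kx ky] := @paley7_common_in (g x) (g y); first by rewrite (can_eq gK).
have [xT yT] : x \in T /\ y \in T by rewrite TE !inE !eqxx orbT.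
exists (f k); apply: (block_uniq hB xy) => //; rewrite ?(out_nbrs_block hr) //.
  by rewrite inE -[x]gK fP.
by rewrite inE -[y]gK fP.
Qed.

(** A permutation respecting arrows permutes the out-neighbourhoods, which are the blocks. *)
Lemma oriented_fano_AutE (s : {perm V}) :
  (s \in oriented_fano_Aut B r) = [forall x, forall y, r (s x) (s y) == r x y].
Proof.
rewrite inE andb_idl // => /'forall_'forall_eqP sr.
have imN x : s @: out_nbrs r x = out_nbrs r (s x).
  by apply/setP=> y; rewrite -[y](permKV s) (mem_imset _ _ perm_inj) !inE sr.
apply/'forall_eqP => T; apply/idP/idP => [/block_out_nbrs[x ->]|].
  by rewrite imN (out_nbrs_block hr).
case/block_out_nbrs => x; rewrite -[x](permKV s) -imN.
by move/(imset_inj perm_inj)->; rewrite (out_nbrs_block hr).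
Qed.

End Labelling.

(** * Transport of permutations along a bijection *)

Section PermConj.

Variables (T U : finType) (f : T -> U) (g : U -> T).
Hypotheses (fK : cancel f g) (gK : cancel g f).

Lemma perm_conj_inj (s : {perm U}) : injective (fun x => g (s (f x))).
Proof. by move=> x y /(can_inj gK)/perm_inj/(can_inj fK). Qed.

Definition perm_conj (s : {perm U}) : {perm T} := perm (@perm_conj_inj s).

Lemma perm_conjM : {morph perm_conj : s t / s * t}.
Proof. by move=> s t; apply/permP=> x; rewrite !permE /= !permE gK. Qed.

End PermConj.

Theorem theorem3p6 (V : finType) (B : {set {set V}}) (r : rel V)
    (hr : oriented_fano_plane B r) :
  oriented_fano_Aut B r \isog F21.
Proof.
have [f [[g fK gK] fP]] := paley7_labelling hr.
pose phi := perm_conj fK gK; pose psi := perm_conj gK fK.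
have phiK : cancel phi psi.
  by move=> s; apply/permP=> x; rewrite !permE !gK.
have psiK : cancel psi phi.
  by move=> s; apply/permP=> x; rewrite !permE !fK.
(* Through the labelling, preserving [r] becomes preserving [paley7], which characterises [F21]. *)
have phiE s : (phi s \in F21) = (s \in oriented_fano_Aut B r).
  rewrite F21_paley7 (oriented_fano_AutE hr).
  apply/'forall_'forall_eqP/'forall_'forall_eqP => sP x y.
    by have := sP (g x) (g y); rewrite !permE -!fP !gK.
  by rewrite !permE -!fP !gK sP.
have phiM : {in oriented_fano_Aut B r &, {morph phi : s t / s * t}}.
  by move=> s t _ _; apply: perm_conjM.
apply/isogP; exists (Morphism phiM).
  by apply/injmP => s t _ _; apply: (can_inj phiK).
rewrite morphimEdom; apply/setP=> t; rewrite -[t]psiK phiE.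
by rewrite (mem_imset _ _ (can_inj phiK)).
Qed.
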